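(* Let $p$ be an odd prime. Then the dihedral group $D_{p^2}$ of order $2p^2$ is a Černý group.
   Context: For a finite set $X$, $T_X$ is the set of all maps $X\to X$, acting on the right of $X$. An automaton with state set $X$ is a subset $\Sigma\subseteq T_X$, written $(X,\Sigma)$. The free monoid $\Sigma^*$ acts on the right of $X$ via the homomorphism $\Sigma^*\to T_X$ extending the inclusion $\Sigma\hookrightarrow T_X$. A word $w\in\Sigma^*$ is synchronizing if $|Xw|=1$; the automaton is synchronizing if it admits a synchronizing word. If $G$ is a finite group with generating set $\Delta$, elements of $\Delta$ are identified with the right translations $g\mapsto gd$ of $G$, so $\Delta\subseteq T_G$; the automaton $(G,\Delta)$ is the Cayley graph of $G$ with respect to $\Delta$. With $n=|G|$, $(G,\Delta)$ is a Černý Cayley graph if every synchronizing automaton $(G,\Sigma)$ with $\Delta\subseteq\Sigma\subseteq T_G$ admits a synchronizing word of length at most $(n-1)^2$. The group $G$ is a Černý group if $(G,\Delta)$ is a Černý Cayley graph for every generating set $\Delta$ of $G$. *)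

(* Defs.v *)
From mathcomp Require Import all_boot all_fingroup all_solvable.
Set Implicit Arguments.
Unset Strict Implicit.
Unset Printing Implicit Defensive.

Section Automaton.
Variable X : finType.

(* An automaton with state set X is given by its set S of transition maps. *)
Definition automaton := {set {ffun X -> X}}.

Definition word_over (S : automaton) (w : seq {ffun X -> X}) : bool :=
  all [in S] w.

(* Right action: the leftmost letter of w is applied first. *)
Definition word_act (x : X) (w : seq {ffun X -> X}) : X :=
  foldl (fun y (f : {ffun X -> X}) => f y) x w.

Definition word_image (w : seq {ffun X -> X}) : {set X} :=
  [set word_act x w | x in [set: X]].

Definition synchronizing_word (S : automaton) (w : seq {ffun X -> X}) : bool :=
  word_over S w && (#|word_image w| == 1%N).

Definition synchronizing (S : automaton) : Prop :=
  exists w, synchronizing_word S w.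

End Automaton.

Section Cerny.
Variable gT : finGroupType.

Definition right_translation (d : gT) : {ffun gT -> gT} :=
  [ffun g => (g * d)%g].

Definition cayley_graph (D : {set gT}) : automaton gT :=
  [set right_translation d | d in D].

Definition cerny_cayley_graph (D : {set gT}) : Prop :=
  forall S : automaton gT,
    cayley_graph D \subset S -> synchronizing S ->
    exists2 w, synchronizing_word S w & size w <= (#|gT| - 1) ^ 2.

End Cerny.

Definition cerny_group (gT : finGroupType) : Prop :=
  forall D : {set gT}, <<D>>%g = [set: gT] -> cerny_cayley_graph D.

(* Main.v *)
From HB Require Import structures.
Require Import Defs.
From mathcomp Require Import all_boot all_fingroup all_solvable.
From mathcomp Require Import all_order all_algebra all_field.
From mathcomp Require Import zify ring.
Set Implicit Arguments.
Unset Strict Implicit.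
Unset Printing Implicit Defensive.
Import Order.TTheory GRing.Theory Num.Theory.

(** Put [N = p ^ 2], so that the group [G] has order [n = 2 * N]. A
    synchronizing word is built backwards. Some letter is not injective, so it
    has a fibre with at least two elements; from then on a proper subset [S] of
    [G] is replaced by a larger preimage of the form [{x | x w \in S}], until
    everything is reached ([chain_of_steps]). There are at most [n - 2] such
    steps and [(n - 1) ^ 2 = 1 + n * (n - 2)], so that [n] letters per step are
    affordable on the average.

    For one step ([expand_set]), let [H] be a subgroup all of whose left cosets
    meet [S] equally. A word [u] gives a vector counting, for each [y], the [x]
    with [x u = y]; call a vector balanced when it gives to every translate of
    [S] by [H] the mass expected from its density. If the vector of [u] is not
    balanced, averaging over [H] produces an [h] in [H] such that more than
    [#|S|] elements are sent to [S] by [u] followed by [h]. A synchronizing word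
    is never balanced, and [escape_word] shows that the length of a shortest
    unbalanced word is at most the dimension of the space of balanced vectors.
    The step therefore costs at most this dimension plus the length of words for
    the elements of [H].

    Every generating set contains either a reflection and a generator [r] of the
    rotations, or two reflections whose product is such an [r]. Hence rotations
    have words of length less than [N], and all elements words of length at most
    [N] ([short_words_exist]).

    The dimension is computed with the Fourier transform on the two cosets of
    the group of rotations. Balanced vectors are described by one linear
    equation ([H] the rotations) or two ([H] everything) at each [N]-th root of
    unity, in the two values of the transform there; the coefficients are the
    transforms [f], [g] of the two parts of [S], of sizes [a] and [b]. Galois
    conjugation makes [f] vanish at all roots of a given order or at none of
    them: if [p] does not divide [a] it vanishes nowhere ([nhat_zero_dvd]), and
    if it vanishes at the roots of order [N] the part is [p]-periodic. If
    [a <> b] and [a + b <> N], the determinant [|f| ^ 2 - |g| ^ 2] of the two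
    equations is nonzero at [p - 1] roots at least ([norm_gap_nonzero]).

    A step from a set of size [k] then costs at most [n + (p - 1)] if [p]
    divides [k], at most [n - (p - 1)] if [k] is odd and prime to [p], and at
    most [n] otherwise ([step_exists]). Single steps can exceed [n], but the
    savings outweigh the excess ([sum_step_cost]). *)

(** * Generators and short words in dihedral groups *)

Local Open Scope group_scope.

(** Presentation-free form of being dihedral of order [2 * q], with a chosen
    generator [r] of the rotations and a chosen reflection [s]; both will be
    changed to suit a given generating set. *)
Definition dihedral_frame (gT : finGroupType) (q : nat) (r s : gT) : Prop :=
  [/\ #|gT| = (2 * q)%N, #[r] = q, s \notin <[r]>, s * s = 1 & r ^ s = r^-1].

Lemma dihedral_frame_exists (gT : finGroupType) (q : nat) :
  1 < q -> [set: gT] \isog 'D_(2 * q)%N ->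
  exists r s : gT, dihedral_frame q r s.
Proof.
move=> q_gt1 isoG.
have oG: #|[set: gT]| = (2 * q)%N.
  by rewrite (card_isog isoG) mul2n card_dihedral.
have := isoG; rewrite mul2n => /isoGrpP-/(_ _ (Grp_dihedral q_gt1)) [_ /existsP].
case=> -[r s] /= /eqP[defG rq1 s21 rs]; exists r, s.
have dvr : #[r] %| q by rewrite order_dvdn rq1.
have dvs : #[s] %| 2 by rewrite order_dvdn s21.
have ler : #[r] <= q by apply: dvdn_leq; rewrite // ltnW.
have les : #[s] <= 2 by apply: dvdn_leq.
have nrs : <[s]> \subset 'N(<[r]>).
  by rewrite norms_cycle rs groupV cycle_id.
have le2q : 2 * q <= #|<[r]>| * #|<[s]> : <[r]>|.
  by rewrite -oG -defG norm_joinEr // -LagrangeMl.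
have lei : #|<[s]> : <[r]>| <= #[s] by rewrite dvdn_leq ?dvdn_indexg.
have ss : s * s = 1 by rewrite -s21 expgS expg1.
have ord : #[r] = q.
  apply/eqP; rewrite eqn_leq ler /= -(leq_pmul2l (isT : 0 < 2)) (leq_trans le2q) //.
  by rewrite mulnC -orderE leq_mul // (leq_trans lei).
split=> //; first by rewrite -cardsT oG.
apply/negP=> sr; have := oG.
rewrite -defG (joing_idPl _) ?cycle_subG // -orderE ord; lia.
Qed.

Lemma prod_nseq_flatten (gT : finGroupType) (l : seq gT) i :
  \prod_(d <- flatten (nseq i l)) d = (\prod_(d <- l) d) ^+ i.
Proof.
by elim: i => [|i IHi]; rewrite ?big_nil //= big_cat IHi expgS.
Qed.

Lemma all_nseq_flatten (gT : finGroupType) (D : {set gT}) l i :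
  all [in D] l -> all [in D] (flatten (nseq i l)).
Proof. by move=> Dl; elim: i => //= i IHi; rewrite all_cat Dl. Qed.

Lemma size_nseq_flatten (T : Type) (l : seq T) i :
  size (flatten (nseq i l)) = (i * size l)%N.
Proof. by elim: i => //= i IHi; rewrite size_cat IHi mulSn. Qed.

Section Frame.

Variables (gT : finGroupType) (q : nat) (r s : gT).
Hypothesis frame : dihedral_frame q r s.

Lemma frame_order_gt0 : 0 < q.
Proof. by have [_ <- _ _ _] := frame; apply: order_gt0. Qed.

Lemma frame_reflect (i : nat) : r ^+ i * s = s * r ^- i.
Proof.
have [_ _ _ _ rs] := frame.
by rewrite conjgC -expVgn -rs conjXg.
Qed.

(** The base point [x0] is kept arbitrary so that the two halves of a set can
    later be exchanged by passing from [x0] to [x0 * s]. *)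
Lemma frame_cosets (x0 : gT) : [disjoint x0 *: <[r]> & (x0 * s) *: <[r]>]
  /\ (x0 *: <[r]> :|: (x0 * s) *: <[r]>)%SET = [set: gT].
Proof.
have [oG or sr ss _] := frame.
have dis : [disjoint x0 *: <[r]> & (x0 * s) *: <[r]>].
  rewrite -setI_eq0; apply/eqP/setP=> x; rewrite !inE !mem_lcoset.
  apply/negP=> /andP[x1 x2]; case/negP: sr.
  have := groupM x1 (groupVr x2).
  by rewrite !invMg ?invgK ?mulgA ?mulgK ?mulVg ?mul1g; apply.
split=> //; apply/eqP; rewrite eqEcard subsetT cardsT oG cardsU.
by rewrite disjoint_setI0 // cards0 subn0 !card_lcoset -orderE or mul2n addnn leqnn.
Qed.

Lemma frame_sum (R : Type) (idx : R) (op : Monoid.com_law idx) (x0 : gT) (F : gT -> R) :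
  \big[op/idx]_x F x =
  op (\big[op/idx]_(i < q) F (x0 * r ^+ i)) (\big[op/idx]_(i < q) F (x0 * s * r ^+ i)).
Proof.
have [dis cov] := frame_cosets x0; have [_ or _ _ _] := frame.
rewrite (eq_bigl [in x0 *: <[r]> :|: (x0 * s) *: <[r]>]) => [|x]; last first.
  by rewrite cov inE.
rewrite (bigID [in x0 *: <[r]>]) /=.
have big_coset y : \big[op/idx]_(x in y *: <[r]>) F x =
    \big[op/idx]_(i < q) F (y * r ^+ i).
  rewrite -(big_imset (h := fun i : 'I_q => y * r ^+ i) (A := 'I_q)) /=.
    apply: eq_bigl => x; rewrite mem_lcoset; apply/idP/imsetP.
      case/cyclePmin=> i; rewrite or => lt_i /(canRL (mulKVg _)) ->.
      by exists (Ordinal lt_i).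
    by case=> i _ ->; rewrite mulKg mem_cycle.
  move=> i j _ _ /mulgI/eqP; rewrite eq_expg_mod_order or !modn_small //.
  by move/eqP/val_inj.
rewrite -!big_coset; congr (op _ _); apply: eq_bigl => x.
  by rewrite in_setU; case: (x \in x0 *: _); rewrite ?andbF.
have := congr1 (fun A : {set gT} => x \in A) cov.
have := disjointFr dis (x := x); rewrite in_setU in_setT.
by case: (x \in x0 *: _) => /= [-> | _ ->].
Qed.

Lemma frame_elt (x : gT) :
  exists2 i, i < q & x = r ^+ i \/ x = s * r ^+ i.
Proof.
have [_ cov] := frame_cosets 1; have [_ or _ _ _] := frame.
have: x \in [set: gT] by rewrite inE.
rewrite -cov in_setU !mem_lcoset => /orP[] /cyclePmin[i].
  by rewrite or ?invg1 ?mul1g => lti ->; exists i; [|left].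
by rewrite or mul1g => lti /(canRL (mulKVg _)) ->; exists i; [|right].
Qed.

(** Working modulo [r ^+ m] serves two purposes: for [m] the order of [r] the
    words represent the group elements themselves, and for a smaller [m] they
    represent them as seen by a set that is invariant under [r ^+ m], at a
    correspondingly smaller cost. The bound is one less for rotations because
    in the cycle of length [2 * m] drawn by two reflections they sit at even
    distance from the identity, and [m] is odd. *)
Definition short_words (D : {set gT}) (m : nat) : Prop :=
  (forall x, x \in <[r]> -> exists w, [/\ all [in D] w, size w < m &
     x^-1 * \prod_(d <- w) d \in <[r ^+ m]>]) /\
  (forall x, exists w, [/\ all [in D] w, size w <= m &
     x^-1 * \prod_(d <- w) d \in <[r ^+ m]>]).

Lemma modn_rotation m i : r ^- i * r ^+ (i %% m) \in <[r ^+ m]>.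
Proof.
rewrite {1}(divn_eq i m) addnC expgD invMg -mulgA mulVg mulg1.
by rewrite mulnC expgM groupV mem_cycle.
Qed.

Lemma short_words_rotation (D : {set gT}) m :
  0 < m -> r \in D -> s \in D -> short_words D m.
Proof.
move=> m_gt0 Dr Ds; have rw i : all [in D] (nseq (i %% m) r).
  by rewrite all_nseq /= Dr orbT.
have prw i : \prod_(d <- nseq (i %% m) r) d = r ^+ (i %% m).
  by elim: (i %% m) => [|k IHk]; rewrite ?big_nil //= big_cons IHk expgS.
split=> [x /cycleP[i ->] | x].
  by exists (nseq (i %% m) r); rewrite rw prw size_nseq ltn_mod modn_rotation.
have [i _ [->|->]] := frame_elt x.
  exists (nseq (i %% m) r).
  rewrite rw prw size_nseq; split; rewrite ?modn_rotation //.
  by rewrite ltnW // ltn_mod.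
exists (s :: nseq (i %% m) r).
rewrite /= Ds rw big_cons prw size_nseq ltn_mod m_gt0; split=> //.
by rewrite invMg !mulgA mulgKV modn_rotation.
Qed.

Lemma complement_rotation m i : i < m ->
  r ^- i * r ^- (m - i) \in <[r ^+ m]>.
Proof.
by move=> lti; rewrite -invMg -expgD subnK ?groupV ?cycle_id // ltnW.
Qed.

(** Two reflections draw a cycle of length [2 * m], which can be walked in
    either direction; the case distinctions choose the shorter one. *)
Lemma short_words_reflection (D : {set gT}) m t :
  odd m -> s \in D -> t \in D -> r = s * t -> t * t = 1 -> short_words D m.
Proof.
have [_ _ _ ss _] := frame.
move=> odd_m Ds Dt def_r tt; have m_gt0 : 0 < m by case: m odd_m.
have prf i : \prod_(d <- flatten (nseq i [:: s; t])) d = r ^+ i.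
  by rewrite prod_nseq_flatten !big_cons big_nil mulg1 -def_r.
have prb i : \prod_(d <- flatten (nseq i [:: t; s])) d = r ^- i.
  rewrite prod_nseq_flatten !big_cons big_nil mulg1 -expVgn; congr (_ ^+ i).
  by apply/esym/eqP; rewrite eq_invg_mul def_r mulgA -(mulgA s) tt mulg1 ss.
have Dst i : all [in D] (flatten (nseq i [:: s; t])).
  by apply: all_nseq_flatten; rewrite /= Ds Dt.
have Dts i : all [in D] (flatten (nseq i [:: t; s])).
  by apply: all_nseq_flatten; rewrite /= Ds Dt.
have red i w : r ^- (i %% m) * \prod_(d <- w) d \in <[r ^+ m]> ->
    r ^- i * \prod_(d <- w) d \in <[r ^+ m]>.
  move=> H; rewrite -[\prod_(d <- w) d](mulKVg (r ^+ (i %% m))) mulgA.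
  by rewrite groupM // modn_rotation.
have rot i : exists w, [/\ all [in D] w, size w < m &
     r ^- i * \prod_(d <- w) d \in <[r ^+ m]>].
  have lti : i %% m < m by rewrite ltn_mod.
  have [le_im|lt_mi] := leqP (2 * (i %% m)) m.
    exists (flatten (nseq (i %% m) [:: s; t])); rewrite Dst size_nseq_flatten /=.
    split=> //; first by lia.
    by apply: red; rewrite prf mulVg group1.
  exists (flatten (nseq (m - i %% m) [:: t; s])); rewrite Dts size_nseq_flatten /=.
  split=> //; first by lia.
  by apply: red; rewrite prb complement_rotation.
split=> [x /cycleP[i ->] | x]; first exact: rot.
have [i _ [->|->]] := frame_elt x.
  by have [w [Dw sw pw]] := rot i; exists w; split; rewrite // ltnW.
have lti : i %% m < m by rewrite ltn_mod.
have redS w : r ^- (i %% m) * (s * \prod_(d <- w) d) \in <[r ^+ m]> ->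
    (s * r ^+ i)^-1 * \prod_(d <- w) d \in <[r ^+ m]>.
  move=> H; have := red i (s :: w); rewrite big_cons => /(_ H).
  by rewrite invMg -mulgA (_ : s^-1 = s) //; apply/eqP; rewrite eq_invg_mul ss.
have [i0|i_gt0] := posnP (i %% m).
  exists [:: s]; rewrite /= Ds; split=> //; apply: redS.
  by rewrite i0 big_cons big_nil mulg1 ss mulg1 invg1 group1.
have [le_im|lt_mi] := leqP (2 * (i %% m)) m.+1.
  exists (t :: flatten (nseq (i %% m).-1 [:: s; t])).
  rewrite /= Dt Dst size_nseq_flatten /=; split=> //; first by lia.
  apply: redS; rewrite big_cons prf (mulgA s) -def_r -expgS prednK //.
  by rewrite mulVg group1.
exists (s :: flatten (nseq (m - i %% m) [:: t; s])).
rewrite /= Ds Dts size_nseq_flatten /=; split=> //; first by lia.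
by apply: redS; rewrite big_cons prb (mulgA s) ss mul1g complement_rotation.
Qed.

End Frame.

Lemma frame_generator (gT : finGroupType) q (r s : gT) i :
  dihedral_frame q r s -> coprime q i -> dihedral_frame q (r ^+ i) s.
Proof.
case=> oG or sr ss rs co_qi; split=> //.
- by rewrite orderXgcd or (eqP co_qi) divn1.
- by apply: contra sr; apply: subsetP; rewrite cycleX.
- by rewrite conjXg rs expVgn.
Qed.

Lemma frame_reflection (gT : finGroupType) q (r s t : gT) :
  dihedral_frame q r s -> t \notin <[r]> ->
  dihedral_frame q r t /\ exists i, t = s * r ^+ i.
Proof.
move=> fr tr; have [i _ [def_t|def_t]] := frame_elt fr t.
  by rewrite def_t mem_cycle in tr.
have [oG or sr ss rs] := fr.
split; last by exists i.
split=> //.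
  by rewrite def_t -mulgA (mulgA _ s) (frame_reflect fr) !mulgA ss mul1g mulVg.
by rewrite def_t conjgM rs conjVg; congr _^-1; apply/conjg_fixP/commgP/commuteX.
Qed.

(** A rotation outside [<[r0 ^+ p]>] generates all rotations. If [D] contained no
    such rotation, and no two reflections with such a product, it would lie in
    the subgroup of order [2 * p] spanned by [r0 ^+ p] and a reflection. *)
Lemma short_words_exist (gT : finGroupType) p (r0 s0 : gT) (D : {set gT}) :
  prime p -> dihedral_frame (p ^ 2) r0 s0 -> <<D>> = [set: gT] ->
  exists r s, dihedral_frame (p ^ 2) r s /\
    forall m, odd m -> short_words r D m.
Proof.
move=> p_pr fr0 genD; have p_gt1 := prime_gt1 p_pr.
have co i : r0 ^+ i \notin <[r0 ^+ p]> -> coprime (p ^ 2) i.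
  apply: contraR; rewrite coprime_pexpl // prime_coprime // negbK => /dvdnP[k ->].
  by rewrite mulnC expgM mem_cycle.
have [oG or0 sr0 _ _] := fr0.
have [s Ds sr] : exists2 s, s \in D & s \notin <[r0]>.
  apply/subsetPn; apply: contra sr0 => sDr.
  have : [set: gT] \subset <[r0]> by rewrite -genD gen_subG.
  by move/subsetP->.
have [fr _] := frame_reflection fr0 sr; have [_ _ _ ss rs] := fr.
have [sDK | /subsetPn[d]] := boolP (D :&: <[r0]> \subset <[r0 ^+ p]>); last first.
  case/setIP=> Dd /cycleP[i def_d] Kd; rewrite def_d in Kd.
  have fri := frame_generator fr (co _ Kd).
  exists (r0 ^+ i), s; split=> // m odd_m.
  apply: (short_words_rotation fri) => //; last by rewrite -def_d.
  by case: m odd_m.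
have [sDsK | /subsetPn[t]] := boolP (D :\: <[r0]> \subset s *: <[r0 ^+ p]>); last first.
  rewrite !inE mem_lcoset => /andP[tr Dt].
  have [[_ _ _ tt _] [i def_t]] := frame_reflection fr tr.
  have s1 : s^-1 = s by apply/eqP; rewrite eq_invg_mul ss.
  have def_ri : r0 ^+ i = s * t by rewrite def_t mulgA ss mul1g.
  rewrite s1 -def_ri => Kri.
  have fri := frame_generator fr (co _ Kri).
  exists (r0 ^+ i), s; split=> // m odd_m.
  exact: (short_words_reflection fri odd_m Ds Dt def_ri tt).
have nKs : <[s]> \subset 'N(<[r0 ^+ p]>).
  by rewrite norms_cycle conjXg rs expVgn groupV cycle_id.
have : r0 \in <[r0 ^+ p]> <*> <[s]>.
  apply: subsetP (in_setT r0); rewrite -genD gen_subG -(setID D <[r0]>) subUset.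
  rewrite (subset_trans sDK) ?joing_subl //= (subset_trans sDsK) //.
  apply/subsetP=> _ /lcosetP[k Kk ->].
  by rewrite groupM ?(subsetP (joing_subl _ _) _ Kk) // mem_gen // inE cycle_id orbT.
have sK : <[r0 ^+ p]> \subset <[r0]> by rewrite cycleX.
rewrite norm_joinEr // => /mulsgP[k y Kk sy def_r0].
have ry : y \in <[r0]>.
  by rewrite -(groupMl _ (subsetP sK _ Kk)) -def_r0 cycle_id.
have y1 : y = 1.
  have os : #[s] = 2.
    by apply: nt_prime_order; rewrite // ?expgS ?expg1 //; apply: contraNneq sr => ->.
  case/cyclePmin: sy ry => i; rewrite os.
  by case: i => [|[|//]] _ -> // rs1; case/negP: sr.
have := Kk; rewrite -[k]mulg1 -y1 -def_r0 -{1}[r0]expg1 => /idP r0K.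
have := subset_leq_card (_ : <[r0]> \subset <[r0 ^+ p]>).
rewrite cycle_subG -[X in X \in _]expg1 r0K => /(_ isT).
rewrite -!orderE orderXdiv or0 ?(dvdn_exp _ (dvdnn p)) // leqNgt.
by rewrite expnS expn1 mulnK ?ltn_Pmulr // ltnW.
Qed.

Local Close Scope group_scope.

(** * Escaping from a subspace, and enlarging a set *)

Local Open Scope ring_scope.

(** If [A] is not invariant, the vectors of [A] that stay in [A] for one more
    letter form a strictly smaller space, from which one can escape by
    induction; the word found, possibly with one more letter, escapes from
    [A]. *)
Lemma escape_word (F : fieldType) (vT : vectType F) (I : finType)
    (T : I -> 'End(vT)) (Sg : {set I}) (e : vT) (A : {vspace vT}) (w : seq I) :
  all [in Sg] w -> foldl (fun v i => T i v) e w \notin A ->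
  exists u, [/\ all [in Sg] u, (size u <= \dim A)%N &
                foldl (fun v i => T i v) e u \notin A].
Proof.
have [d le_d] := ubnP (\dim A); elim: d => // d IHd in A le_d * => Sw Aw.
pose A' := (A :&: \bigcap_(i in Sg) (T i @^-1: A))%VS.
have A'P v : v \in A -> (forall i, i \in Sg -> T i v \in A) -> v \in A'.
  move=> Av ATv; rewrite memv_cap Av memvE; apply/subv_bigcapP=> i Si.
  by rewrite -memvE -memv_preim ATv.
have sA'A : (A' <= A)%VS by apply: capvSl.
have [leAA'|nleAA'] := boolP (A <= A')%VS.
  exists [::]; split=> //=; apply: contra Aw.
  clear IHd; elim: w e Sw => [//|i w IHw] e /= /andP[Si Sw] Ae; apply: IHw => //.
  have := subvP leAA' _ Ae; rewrite memv_cap memvE => /andP[_ /subv_bigcapP].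
  by move/(_ _ Si); rewrite -memvE -memv_preim.
have ltA' : (\dim A' < \dim A)%N.
  by rewrite (ltn_leqif (dimv_leqif_sup sA'A)).
have := IHd A' (leq_trans ltA' le_d) Sw (contra (subvP sA'A _) Aw).
case=> u [Su le_u A'u]; have [Au|nAu] := boolP (foldl (fun v i => T i v) e u \in A).
  have [/forall_inP TA|] :=
    boolP [forall i in Sg, T i (foldl (fun v i => T i v) e u) \in A].
    by rewrite A'P in A'u.
  rewrite negb_forall_in => /exists_inP[i Si nAi].
  exists (rcons u i); rewrite all_rcons Su Si size_rcons foldl_rcons; split=> //.
  exact: leq_ltn_trans ltA'.
by exists u; split=> //; apply: leq_trans (dimvS sA'A).
Qed.

Section KernelOperator.

Variables (X Y : finType) (F : fieldType) (c : X -> Y -> F).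

Definition kernel_fun (v : {ffun X -> F^o}) : {ffun Y -> F^o} :=
  [ffun y => \sum_x v x * c x y].

Fact kernel_fun_linear : linear kernel_fun.
Proof.
move=> a u v; apply/ffunP=> y; rewrite !ffunE scaler_sumr -big_split /=.
by apply: eq_bigr => x _; rewrite !ffunE mulrDl scalerAl.
Qed.

HB.instance Definition _ :=
  GRing.isLinear.Build F {ffun X -> F^o} {ffun Y -> F^o} _ kernel_fun
    kernel_fun_linear.

Definition kernel_op : 'Hom({ffun X -> F^o}, {ffun Y -> F^o}) := linfun kernel_fun.

Lemma kernel_opE v y : kernel_op v y = \sum_x v x * c x y.
Proof. by rewrite lfunE ffunE. Qed.

End KernelOperator.

Lemma dim_ffun_regular (X : finType) (F : fieldType) : \dim {: {ffun X -> F^o}} = #|X|.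
Proof. by rewrite dimvf /dim /= muln1. Qed.

Lemma dim_le_functionals (X J : finType) (F : fieldType)
    (A : {vspace {ffun X -> F^o}}) (c : X -> J -> F) :
  (forall v, v \in A -> (forall j, \sum_x v x * c x j = 0) -> v = 0) ->
  (\dim A <= #|J|)%N.
Proof.
move=> inj_c; rewrite -(@limg_dim_eq _ _ _ (kernel_op c)) ?dim_ffun_regular //.
  by rewrite -(dim_ffun_regular J F) dimvS ?subvf.
apply/eqP; rewrite -subv0; apply/subvP=> v.
rewrite memv_cap memv_ker => /andP[Av /eqP cv].
rewrite memv0; apply/eqP/inj_c=> // j.
by rewrite -kernel_opE cv ffunE.
Qed.

Section Expansion.

Variables (gT : finGroupType) (Sg : automaton gT).

Lemma word_act_cat (x : gT) u w : word_act x (u ++ w) = word_act (word_act x u) w.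
Proof. exact: foldl_cat. Qed.

(** Push-forward of the counting measure under the word [w]. *)
Definition fiber_count (w : seq {ffun gT -> gT}) : {ffun gT -> algC^o} :=
  [ffun y => \sum_x (word_act x w == y)%:R].

Definition push_forward (f : {ffun gT -> gT}) :=
  kernel_op (F := algC) (fun x y => (f x == y)%:R).

Lemma sum_fiber_count w (F : gT -> algC) :
  \sum_y (fiber_count w y : algC) * F y = \sum_x F (word_act x w).
Proof.
transitivity (\sum_y \sum_x (word_act x w == y)%:R * F y).
  by apply: eq_bigr => y _; rewrite ffunE mulr_suml.
rewrite exchange_big; apply: eq_bigr => x _ /=.
rewrite (bigD1 (word_act x w)) //= eqxx mul1r big1 ?addr0 // => y.
by rewrite eq_sym => /negPf->; rewrite mul0r.
Qed.

Lemma fiber_count_word w :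
  foldl (fun v f => push_forward f v) (fiber_count [::]) w = fiber_count w.
Proof.
elim/last_ind: w => // w f IHw; rewrite foldl_rcons IHw; apply/ffunP=> y.
rewrite kernel_opE sum_fiber_count ffunE.
by apply: eq_bigr => x _; rewrite /word_act foldl_rcons.
Qed.

(** The [#|gT|]-fold difference between membership of [x * h] in [S] and the
    density of [S]; scaling avoids a division. Indices outside [H] give no
    condition, so that the kernel below has a codomain of fixed type. *)
Definition discrepancy (S H : {set gT}) (x h : gT) : algC :=
  if h \in H then #|gT|%:R * (x * h \in S)%g%:R - #|S|%:R else 0.

Definition balanced (S H : {set gT}) : {vspace {ffun gT -> algC^o}} :=
  lker (kernel_op (discrepancy S H)).

Lemma balancedP (S H : {set gT}) (v : {ffun gT -> algC^o}) :
  reflect (forall h, h \in H ->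
    #|gT|%:R * (\sum_x (v x : algC) * (x * h \in S)%g%:R) =
    #|S|%:R * (\sum_x (v x : algC)))
  (v \in balanced S H).
Proof.
have eqd h : h \in H -> kernel_op (discrepancy S H) v h =
    #|gT|%:R * (\sum_x (v x : algC) * (x * h \in S)%g%:R) -
    #|S|%:R * (\sum_x (v x : algC)).
  move=> Hh; rewrite kernel_opE !mulr_sumr -sumrB; apply: eq_bigr => x _.
  by rewrite /discrepancy Hh mulrBr mulrCA [_ * #|S|%:R]mulrC.
rewrite memv_ker; apply: (iffP eqP) => [v0 h Hh | vH].
  by apply/eqP; rewrite -subr_eq0 -eqd // v0 ffunE.
apply/ffunP=> h; have [Hh|nHh] := boolP (h \in H).
  by rewrite eqd // vH // subrr ffunE.
rewrite kernel_opE ffunE big1 // => x _.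
by rewrite /discrepancy (negPf nHh) mulr0.
Qed.

Lemma balanced_count (S H : {set gT}) w : reflect
  (forall h, h \in H -> #|[set x | (word_act x w * h)%g \in S]| = #|S|)
  (fiber_count w \in balanced S H).
Proof.
have eq1 h : \sum_x (fiber_count w x : algC) * (x * h \in S)%g%:R =
    #|[set x | (word_act x w * h)%g \in S]|%:R.
  rewrite sum_fiber_count -sum1_card natr_sum [RHS]big_mkcond /=.
  by apply: eq_bigr => x _; rewrite inE; case: (_ \in S).
have eq2 : \sum_x (fiber_count w x : algC) = #|gT|%:R.
  transitivity (\sum_x (fiber_count w x : algC) * 1).
    by apply: eq_bigr => x _; rewrite mulr1.
  by rewrite sum_fiber_count sumr_const.
have n0 : #|gT|%:R != 0 :> algC by rewrite pnatr_eq0 -cardsT -lt0n cardG_gt0.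
apply: (iffP (balancedP _ _ _)) => Hw h Hh; have := Hw h Hh.
  rewrite eq1 eq2 mulrC => /(mulIf n0)/eqP.
  by rewrite eqr_nat => /eqP.
by rewrite eq1 eq2 mulrC => ->.
Qed.

(** Averaging over [H]: when all left cosets of [H] meet [S] in the same number
    of points, no word does better than [#|S|] on the average. *)
Lemma sum_count_translates (S : {set gT}) (H : {group gT}) w :
  (forall x, #|(x *: H)%g :&: S| * #|gT| = #|H| * #|S|)%N ->
  (\sum_(h in H) #|[set x | (word_act x w * h)%g \in S]| = #|H| * #|S|)%N.
Proof.
move=> eqH; have n_gt0 : (0 < #|gT|)%N by rewrite -cardsT cardG_gt0.
apply/eqP; rewrite -(eqn_pmul2r n_gt0); apply/eqP.
transitivity (\sum_(x : gT) #|((word_act x w) *: H)%g :&: S| * #|gT|)%N.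
  rewrite -big_distrl /=; congr (_ * _)%N.
  transitivity (\sum_(h in H) \sum_x ((word_act x w * h)%g \in S))%N.
    apply: eq_bigr => h _; rewrite -sum1_card big_mkcond /=.
    by apply: eq_bigr => x _; rewrite inE; case: (_ \in S).
  rewrite exchange_big; apply: eq_bigr => x _ /=.
  rewrite -big_mkcondr sum1_card -(card_imset _ (mulgI (word_act x w))).
  apply: eq_card => y; rewrite !inE mem_lcoset; apply/imsetP/andP.
    by case=> h /andP[Hh Sh] ->; rewrite mulKg.
  case=> Hy Sy; exists ((word_act x w)^-1 * y)%g; last by rewrite mulKVg.
  by apply/andP; rewrite mulKVg.
by rewrite (eq_bigr _ (fun x _ => eqH _)) sum_nat_const mulnC.
Qed.

(** A word that sends everything to one point is not balanced, so a word [u] of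
    length at most the dimension of the balanced vectors is not balanced
    either. By [sum_count_translates] some element of [H] then gives a count
    above the mean, and the desired word is [u] followed by a word acting on
    [S] like that element. *)
Lemma expand_set (S : {set gT}) (H : {group gT}) L a :
  synchronizing Sg -> (0 < #|S| < #|gT|)%N ->
  (forall x, #|(x *: H)%g :&: S| * #|gT| = #|H| * #|S|)%N ->
  (forall h, h \in H -> exists w, [/\ word_over Sg w, (size w <= L)%N &
     forall x, (word_act x w \in S) = ((x * h)%g \in S)]) ->
  (\dim (balanced S H) <= a)%N ->
  exists w, [/\ word_over Sg w, (size w <= a + L)%N &
    (#|S| < #|[set x | word_act x w \in S]|)%N].
Proof.
move=> [w0 /andP[Sw0 /cards1P[z im_w0]]] /andP[S_gt0 S_lt] eqH wH le_a.
have act0 x : word_act x w0 = z.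
  by apply/set1P; rewrite -im_w0; apply: imset_f.
have nbal : fiber_count w0 \notin balanced S H.
  apply/balanced_count=> /(_ 1%g (group1 _)).
  have [Sz|nSz] := boolP (z \in S); [move: S_lt|move: S_gt0] => /[swap] <-.
    rewrite (eq_card (B := gT)) ?ltnn // => x.
    by rewrite !inE act0 mulg1 Sz.
  rewrite (eq_card0 (A := [set x | _])) // => x.
  by rewrite !inE act0 mulg1 (negPf nSz).
have [u [Su le_u]] : exists u, [/\ all [in Sg] u, (size u <= \dim (balanced S H))%N &
    foldl (fun v f => push_forward f v) (fiber_count [::]) u \notin balanced S H].
  by apply: (escape_word Sw0); rewrite fiber_count_word.
rewrite fiber_count_word => /balanced_count nbu.
have [h Hh lt_h] : exists2 h, h \in H &
    (#|S| < #|[set x | (word_act x u * h)%g \in S]|)%N.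
  apply/exists_inP; apply: contra_notT nbu; rewrite negb_exists_in.
  move=> /forall_inP le_h h Hh.
  have leh h' : h' \in H -> (#|[set x | (word_act x u * h')%g \in S]| <= #|S|)%N.
    by move=> Hh'; rewrite leqNgt le_h.
  apply/eqP; have := sum_count_translates u eqH.
  move/eqP; rewrite -sum_nat_const (leqif_sum (fun h' Hh' => leqif_eq (leh h' Hh'))).2.
  by move/forall_inP; apply.
have [w [Sw sw actw]] := wH h Hh.
exists (u ++ w); split; first by rewrite /word_over all_cat Su; apply: Sw.
  by rewrite size_cat leq_add // (leq_trans le_u).
apply: leq_trans lt_h _; rewrite subset_leq_card //; apply/subsetP=> x.
by rewrite !inE word_act_cat actw.
Qed.

End Expansion.

(** * Fourier transform at roots of unity *)

Lemma geometric_sum_root (F : fieldType) N (w : F) :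
  w ^+ N = 1 -> w != 1 -> \sum_(i < N) w ^+ i = 0.
Proof.
move=> wN w1; apply: (mulfI (_ : w - 1 != 0)); first by rewrite subr_eq0.
by rewrite -subrX1 wN subrr mulr0.
Qed.

Lemma unity_root_neq0 (F : fieldType) N (w : F) :
  (0 < N)%N -> w ^+ N = 1 -> w != 0.
Proof.
move=> N_gt0; apply: contra_eq_neq => ->.
by rewrite expr0n gtn_eqF // eq_sym oner_neq0.
Qed.

Section Fourier.

Variables (F : fieldType) (N : nat).
Implicit Types (f v : nat -> F) (w z : F).

Definition periodic (T : Type) (f : nat -> T) := forall i, f (i + N)%N = f i.

(** Discrete Fourier transform, indexed by the root of unity [w]. *)
Definition hat f w : F := \sum_(i < N) f i * w ^+ i.

Lemma hat1 f : hat f 1 = \sum_(i < N) f i.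
Proof. by apply: eq_bigr => i _; rewrite expr1n mulr1. Qed.

Lemma sum_periodic f k : periodic f -> \sum_(i < N) f (k + i)%N = \sum_(i < N) f i.
Proof.
move=> per_f; elim: k => [|k IHk]; first by apply: eq_bigr.
rewrite -{}IHk; apply: (addrI (f k)).
have := @big_ord_recl F 0 +%R N (fun i : 'I_N.+1 => f (k + i)%N).
rewrite (@big_ord_recr F 0 +%R N (fun i : 'I_N.+1 => f (k + i)%N)) /=.
rewrite addn0 per_f addrC => ->; congr (_ + _).
by apply: eq_bigr => i _; rewrite /bump /= addnS.
Qed.

Lemma hat_shift f k w : periodic f -> w ^+ N = 1 ->
  w ^+ k * \sum_(j < N) f (k + j)%N * w ^+ j = hat f w.
Proof.
move=> per_f wN; rewrite mulr_sumr.
transitivity (\sum_(j < N) f (k + j)%N * w ^+ (k + j)).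
  by apply: eq_bigr => j _; rewrite exprD mulrCA.
apply: (sum_periodic (f := fun j => f j * w ^+ j)) => j.
by rewrite per_f exprD wN mulr1.
Qed.

Lemma hat_correlation v f w : periodic f -> w ^+ N = 1 -> w != 0 ->
  \sum_(j < N) (\sum_(i < N) v i * f (i + j)%N) * w ^+ j = hat v w^-1 * hat f w.
Proof.
move=> per_f wN w0; under eq_bigr do rewrite mulr_suml.
rewrite [RHS]mulr_suml.
rewrite exchange_big; apply: eq_bigr => i _ /=.
rewrite -(hat_shift i per_f wN) exprVn -mulrA mulKf ?expf_neq0 // mulr_sumr.
by apply: eq_bigr => j _; rewrite mulrA.
Qed.

Lemma hat_convolution v f w : periodic f -> w ^+ N = 1 -> w != 0 ->
  \sum_(j < N) (\sum_(i < N) v i * f (N - i + j)%N) * w ^+ j = hat v w * hat f w.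
Proof.
move=> per_f wN w0; under eq_bigr do rewrite mulr_suml.
rewrite [RHS]mulr_suml.
rewrite exchange_big; apply: eq_bigr => i _ /=.
rewrite -(hat_shift (N - i) per_f wN) -mulrA [w ^+ i * _]mulrA -exprD.
rewrite subnKC ?wN 1?ltnW // mul1r mulr_sumr.
by apply: eq_bigr => j _; rewrite mulrA.
Qed.

Variable z : F.
Hypothesis prim_z : N.-primitive_root z.

Let wN l : (z ^+ l) ^+ N = 1.
Proof. by rewrite exprAC (prim_expr_order prim_z) expr1n. Qed.

Let z0 : z != 0.
Proof.
exact: unity_root_neq0 (prim_order_gt0 prim_z) (prim_expr_order prim_z).
Qed.

Lemma root_orthogonality (i k : 'I_N) :
  \sum_(l < N) (z ^+ l) ^+ i * ((z ^+ l)^-1) ^+ k = N%:R * (i == k)%:R.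
Proof.
transitivity (\sum_(l < N) (z ^+ i / z ^+ k) ^+ l).
  by apply: eq_bigr => l _; rewrite exprMn !exprVn (exprAC _ l i) (exprAC _ l k).
have [->|neq_ik] := eqVneq i k.
  rewrite divff ?expf_neq0 // (eq_bigr (fun=> 1)) => [|l _]; last exact: expr1n.
  by rewrite sumr_const card_ord mulr1.
rewrite mulr0 geometric_sum_root //.
  by rewrite exprMn exprVn !wN divr1.
rewrite -(inj_eq (mulIf (expf_neq0 k z0))) mulfVK ?expf_neq0 // mul1r.
by rewrite (eq_prim_root_expr prim_z) !modn_small.
Qed.

Lemma sum_hat_dual f (k : 'I_N) :
  \sum_(l < N) hat f (z ^+ l) * ((z ^+ l)^-1) ^+ k = N%:R * f k.
Proof.
transitivity (\sum_(i < N) f i * (N%:R * (i == k)%:R)).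
  under eq_bigr do rewrite mulr_suml.
  rewrite exchange_big; apply: eq_bigr => i _ /=.
  rewrite -root_orthogonality mulr_sumr; apply: eq_bigr => l _.
  by rewrite mulrA.
rewrite (bigD1 k) //= eqxx mulr1 mulrC big1 ?addr0 // => i /negPf->.
by rewrite !mulr0.
Qed.

Lemma hat_inj f : N%:R != 0 :> F ->
  (forall l, (l < N)%N -> hat f (z ^+ l) = 0) ->
  forall i, (i < N)%N -> f i = 0.
Proof.
move=> N0 f0 i ltiN; have := sum_hat_dual f (Ordinal ltiN).
rewrite big1 => [/esym/eqP|l _]; last by rewrite f0 ?mul0r.
by rewrite mulf_eq0 (negPf N0) => /eqP.
Qed.

Lemma parseval f :
  \sum_(l < N) hat f (z ^+ l) * hat f ((z ^+ l)^-1) = N%:R * \sum_(i < N) f i ^+ 2.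
Proof.
under eq_bigr do rewrite [hat f _^-1]/hat mulr_sumr.
rewrite exchange_big mulr_sumr; apply: eq_bigr => i _ /=.
rewrite expr2 mulrA -sum_hat_dual mulr_suml; apply: eq_bigr => l _.
by rewrite mulrCA mulrC.
Qed.

(** The roots [z ^+ l] with [e %| l] are the [d]-th roots of unity, so outside
    them the transform of [f (i + d) - f i] vanishes by hypothesis, and on them
    it vanishes because of the factor [w ^+ d - 1]. *)
Lemma hat_zero_periodic f d e : N%:R != 0 :> F -> periodic f -> (N = d * e)%N ->
  (forall l, (l < N)%N -> ~~ (e %| l)%N -> hat f (z ^+ l) = 0) ->
  forall i, f (i + d)%N = f i.
Proof.
move=> N0 per_f defN f0 i; apply/eqP; rewrite -subr_eq0.
pose g i := f (i + d)%N - f i.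
have per_g : periodic g by move=> k; rewrite /g addnAC !per_f.
have gi k : g (k %% N)%N = g k.
  rewrite {2}(divn_eq k N); elim: (k %/ N)%N => [|m IHm]; first by rewrite mul0n.
  by rewrite mulSnr addnAC per_g.
rewrite -/(g i) -gi; have N_gt0 := prim_order_gt0 prim_z.
apply/eqP/hat_inj; rewrite ?ltn_mod // => l ltl.
have hat_g : z ^+ l ^+ d * hat g (z ^+ l) = (1 - z ^+ l ^+ d) * hat f (z ^+ l).
  rewrite mulrBl mul1r -{1}(hat_shift d per_f (wN l)) -mulrBr; congr (_ * _).
  rewrite /hat -sumrB; apply: eq_bigr => j _.
  by rewrite -mulrBl addnC.
apply/eqP; rewrite -(mulrI_eq0 _ (mulfI (expf_neq0 d (expf_neq0 l z0)))) hat_g.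
have [/dvdnP[k ->]|nel] := boolP (e %| l)%N; last by rewrite f0 ?mulr0.
rewrite -exprM -mulnA [(e * d)%N]mulnC -defN mulnC exprM (prim_expr_order prim_z).
by rewrite expr1n subrr mul0r.
Qed.

End Fourier.

(** Transforms of integer-valued functions commute with field automorphisms, so
    that a zero at one primitive root forces zeros at all roots of the same
    order. *)
Lemma primitive_conjugate m (w w' : algC) :
  m.-primitive_root w -> m.-primitive_root w' ->
  exists u : {rmorphism algC -> algC}, u w = w'.
Proof.
move=> prim_w prim_w'.
have [i def_w'] := prim_rootP prim_w (prim_expr_order prim_w').
have co_im : coprime i m by rewrite -(prim_root_exp_coprime i prim_w) -def_w'.
have [u uE] := Qn_aut_exists co_im.
by exists u; rewrite uE ?(prim_expr_order prim_w).
Qed.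

Definition nhat (N : nat) (c : nat -> nat) (w : algC) : algC :=
  hat N (fun i => (c i)%:R) w.

Lemma nhat1 N c : nhat N c 1 = (\sum_(i < N) c i)%:R.
Proof. by rewrite /nhat hat1 natr_sum. Qed.

Lemma rmorph_nhat N c (u : {rmorphism algC -> algC}) w :
  u (nhat N c w) = nhat N c (u w).
Proof.
rewrite rmorph_sum; apply: eq_bigr => i _.
by rewrite rmorphM rmorphXn rmorph_nat.
Qed.

Lemma sum_blocks (c : nat -> nat) p k :
  (forall i, c (i + p) = c i)%N -> (\sum_(i < k * p) c i = k * \sum_(i < p) c i)%N.
Proof.
move=> per_c; elim: k => [|k IHk]; first by rewrite big_ord0.
rewrite mulSnr big_split_ord /= IHk mulSnr; congr (_ + _)%N.
apply: eq_bigr => i _; elim: k {IHk} => [|k IHk] //.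
by rewrite mulSnr addnAC per_c.
Qed.

Section PrimeSquare.

Variable p : nat.
Hypothesis p_pr : prime p.
Let N := (p ^ 2)%N.
Let p_gt0 : (0 < p)%N. Proof. exact: prime_gt0. Qed.
Let p_gt1 : (1 < p)%N. Proof. exact: prime_gt1. Qed.

Lemma nhat_periodic (c : nat -> nat) (z : algC) :
  N.-primitive_root z -> periodic N c ->
  (exists2 l, ~~ (p %| l)%N & nhat N c (z ^+ l) = 0) ->
  forall i, c (i + p)%N = c i.
Proof.
move=> prim_z per_c [l pl cl0] i; apply/eqP; rewrite -(eqr_nat algC); apply/eqP.
have prim_pow k : ~~ (p %| k)%N -> N.-primitive_root (z ^+ k).
  by rewrite prim_root_exp_coprime // coprime_sym coprime_pexpl // prime_coprime.
apply: (hat_zero_periodic prim_z (f := fun i => (c i)%:R)) i.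
- by rewrite pnatr_eq0 -lt0n expn_gt0 p_gt0.
- by move=> i; rewrite per_c.
- exact: mulnn.
move=> k _ pk; have [u uE] := primitive_conjugate (prim_pow l pl) (prim_pow k pk).
by have := congr1 u cl0; rewrite rmorph0 rmorph_nhat uE.
Qed.

(** If [w] has order [p], the transform vanishes at all nontrivial [p]-th roots
    and summing it over all [p]-th roots gives [p] times an integer. If [w] has
    order [p ^ 2], then [c] is [p]-periodic. *)
Lemma nhat_zero_dvd (c : nat -> nat) (w : algC) :
  periodic N c -> w ^+ N = 1 -> nhat N c w = 0 -> (p %| \sum_(i < N) c i)%N.
Proof.
move=> per_c wN cw0; have N_gt0 : (0 < N)%N by rewrite expn_gt0 p_gt0.
have [m prim_w /(dvdn_pfactor _ _ p_pr)[e le_e def_m]] := prim_order_exists N_gt0 wN.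
have {le_e def_m} : [\/ m = 1%N, m = p | m = N].
  by case: e le_e def_m => [|[|[|//]]] _ ->; [constructor 1|constructor 2|constructor 3].
case=> def_m; subst m.
- have w1 : w = 1 by have := prim_expr_order prim_w.
  by move/eqP: cw0; rewrite w1 nhat1 pnatr_eq0 => /eqP->; rewrite dvdn0.
- have sum_w : \sum_(l < p) nhat N c (w ^+ l) = (\sum_(i < N) c i)%:R.
    rewrite (bigD1 (Ordinal p_gt0)) //= expr0 nhat1 [X in _ + X]big1 ?addr0 // => l l0.
    have prim_wl : p.-primitive_root (w ^+ l).
      rewrite prim_root_exp_coprime // coprime_sym prime_coprime //.
      by rewrite gtnNdvd ?ltn_ord // lt0n.
    have [u uE] := primitive_conjugate prim_w prim_wl.
    by have := congr1 u cw0; rewrite rmorph0 rmorph_nhat uE.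
  have : \sum_(l < p) nhat N c (w ^+ l) = (p * \sum_(i < N) c i * (p %| i))%:R.
    rewrite exchange_big natrM natr_sum mulr_sumr; apply: eq_bigr => i _ /=.
    rewrite -mulr_sumr natrM mulrCA; congr (_ * _).
    transitivity (\sum_(l < p) (w ^+ i) ^+ l : algC).
      by apply: eq_bigr => l _; rewrite exprAC.
    have [pi|npi] := boolP (p %| i)%N.
      have -> : w ^+ i = 1 by apply/eqP; rewrite -(prim_order_dvd prim_w).
      by under eq_bigr do rewrite expr1n; rewrite sumr_const card_ord mulr1.
    rewrite mulr0 geometric_sum_root // -?(prim_order_dvd prim_w) //.
    by rewrite exprAC (prim_expr_order prim_w) expr1n.
  rewrite sum_w => /eqP; rewrite eqr_nat => /eqP->; exact: dvdn_mulr.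
have per_p : forall i, c (i + p)%N = c i.
  apply: (nhat_periodic prim_w) => //; exists 1%N; rewrite ?expr1 //.
  by rewrite gtnNdvd.
have -> : N = (p * p)%N by rewrite mulnn.
by rewrite sum_blocks // dvdn_mulr.
Qed.

(** As [w^-1] is the complex conjugate of [w], this is the difference of the
    squared moduli of the two transforms. *)
Definition norm_gap (c d : nat -> nat) (w : algC) : algC :=
  nhat N c w * nhat N c w^-1 - nhat N d w * nhat N d w^-1.

(** If the gap vanished at all nontrivial roots, Parseval's identity would equate
    [N * (a - b)] with its value [a ^ 2 - b ^ 2] at 1, which forces [a = b] or
    [a + b = N]. A nonzero value at one root spreads to its conjugates, and
    [q] is chosen so that [z ^+ (t * q)] runs through [p - 1] of them. *)
Lemma norm_gap_nonzero (c d : nat -> nat) (z : algC) :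
  N.-primitive_root z ->
  (forall i, c i <= 1)%N -> (forall i, d i <= 1)%N ->
  let a := (\sum_(i < N) c i)%N in let b := (\sum_(i < N) d i)%N in
  a <> b -> (a + b)%N <> N ->
  exists2 q, (q == 1%N) || (q == p) &
    forall t, (0 < t < p)%N -> norm_gap c d (z ^+ (t * q)) != 0.
Proof.
move=> prim_z c1 d1 a b neq_ab neq_abN.
have N_gt0 : (0 < N)%N by rewrite expn_gt0 p_gt0.
have sq e (e1 : forall i, (e i <= 1)%N) :
    \sum_(i < N) (e i)%:R ^+ 2 = (\sum_(i < N) e i)%:R :> algC.
  rewrite natr_sum; apply: eq_bigr => i _; have := e1 i.
  by case: (e i) => [|[|//]] _; rewrite ?expr0n ?expr1n.
have sum_gap : \sum_(l < N) norm_gap c d (z ^+ l) = N%:R * (a%:R - b%:R).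
  by rewrite sumrB !parseval // !sq // -mulrBr.
have gap1 : norm_gap c d 1 = (a%:R - b%:R) * (a + b)%:R.
  by rewrite /norm_gap invr1 !nhat1 -/a -/b natrD; ring.
have [l l_gt0 gl0] : exists2 l : 'I_N, (0 < l)%N & norm_gap c d (z ^+ l) != 0.
  apply/exists_inP; apply: contra_notT neq_abN; rewrite negb_exists_in.
  move/forall_inP=> gap0; move: sum_gap.
  rewrite (bigD1 (Ordinal N_gt0)) //= expr0 gap1 [X in _ + X]big1 => [|l]; last first.
    by rewrite -lt0n => /gap0; rewrite negbK => /eqP.
  rewrite addr0 mulrC => /mulIf/eqP; rewrite subr_eq0 !eqr_nat => H.
  by apply/eqP; apply: H; apply/eqP.
have zN k : (z ^+ k) ^+ N = 1 by rewrite exprAC (prim_expr_order prim_z) expr1n.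
have [m prim_zl dv_m] := prim_order_exists N_gt0 (zN l).
have m1 : m != 1%N.
  apply: contraL l_gt0 => /eqP m1; rewrite lt0n negbK.
  have /eqP : z ^+ l = 1 by have := prim_expr_order prim_zl; rewrite m1.
  by rewrite -(prim_order_dvd prim_z) /dvdn modn_small.
have prim_q := dvdn_prim_root prim_z dv_m.
exists (N %/ m)%N.
  have /dvdn_pfactor[//|e le_e def_m] := dv_m; rewrite def_m in m1 *.
  case: e le_e {def_m} m1 => [|[|[|//]]] // _ _; last by rewrite divnn N_gt0.
  by rewrite /N expnS expn1 mulnK // eqxx orbT.
move=> t /andP[t_gt0 lt_tp].
have prim_tq : m.-primitive_root (z ^+ (t * (N %/ m))).
  rewrite mulnC exprM prim_root_exp_coprime //.
  have /dvdn_pfactor[//|e _ ->] := dv_m.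
  by rewrite coprimeXr // coprime_sym prime_coprime // gtnNdvd.
have [u uE] := primitive_conjugate prim_zl prim_tq.
have <- : u (norm_gap c d (z ^+ l)) = norm_gap c d (z ^+ (t * (N %/ m))).
  by rewrite rmorphB !rmorphM !rmorph_nhat fmorphV uE.
by rewrite fmorph_eq0.
Qed.

End PrimeSquare.

(** * Dimension of the balanced vectors *)

Section BalancedDimension.

Variables (gT : finGroupType) (N : nat) (r s : gT).
Hypothesis frame : dihedral_frame N r s.
Variables (S : {set gT}) (z : algC).
Hypothesis prim_z : N.-primitive_root z.

Let N_gt0 : (0 < N)%N := frame_order_gt0 frame.

Definition coset_ind (x : gT) (i : nat) : nat := (x * r ^+ i)%g \in S.
Definition coset_size (x : gT) : nat := (\sum_(i < N) coset_ind x i)%N.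
Definition on_coset (v : {ffun gT -> algC^o}) (x : gT) (i : nat) : algC :=
  v (x * r ^+ i)%g.

Lemma coset_ind_periodic x : periodic N (coset_ind x).
Proof.
have [_ or _ _ _] := frame; move=> i.
by rewrite /coset_ind expgD (_ : r ^+ N = 1)%g ?mulg1 // -or expg_order.
Qed.

Lemma coset_size_sum x : (coset_size x + coset_size (x * s)%g)%N = #|S|.
Proof.
rewrite -sum1_card big_mkcond /= (frame_sum frame _ x) /=.
by congr (_ + _)%N; apply: eq_bigr => i _; rewrite /coset_ind; case: (_ \in S).
Qed.

Lemma coset_size_card x : #|((x *: <[r]>)%g :&: S)| = coset_size x.
Proof.
have [_ or _ _ _] := frame.
rewrite -sum1_card big_mkcond /= (frame_sum frame _ x) /=.
rewrite [X in (_ + X)%N]big1 ?addn0 => [|i _]; last first.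
  have [dis _] := frame_cosets frame x.
  rewrite inE (disjointFl dis) //.
  by rewrite mem_lcoset mulKg mem_cycle.
apply: eq_bigr => i _; rewrite inE mem_lcoset mulKg mem_cycle /coset_ind /=.
by case: (_ \in S).
Qed.

Lemma coset_size_lcoset x y : y \in (x *: <[r]>)%g -> coset_size y = coset_size x.
Proof. by rewrite -!coset_size_card => /lcoset_eqP ->. Qed.

Lemma root_unit l : (z ^+ l) ^+ N = 1 /\ z ^+ l != 0.
Proof.
have zN : z ^+ N = 1 := prim_expr_order prim_z.
split; first by rewrite exprAC zN expr1n.
by rewrite expf_neq0 // (unity_root_neq0 N_gt0 zN).
Qed.

(** A vector is determined by the transforms of its two halves. For vectors of
    [W] the second half vanishes at the roots in [dbl] and, outside [bad],
    determines the first half; the remaining values bound the dimension. *)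
Lemma dim_le_hat (W : {vspace {ffun gT -> algC^o}}) (x : gT) (dbl bad : pred 'I_N) :
  (forall v l, v \in W -> dbl l -> hat N (on_coset v (x * s)%g) (z ^+ l) = 0) ->
  (forall v l, v \in W -> ~~ bad l -> hat N (on_coset v (x * s)%g) (z ^+ l) = 0 ->
     hat N (on_coset v x) (z ^+ l) = 0) ->
  (\dim W <= (N - #|dbl|) + #|bad|)%N.
Proof.
move=> Hdbl Hbad.
pose J : finType := ({l | ~~ dbl l} + {l | bad l})%type.
pose c (y : gT) (j : J) : algC :=
  match j with
  | inl l => \sum_(i < N) (y == x * s * r ^+ i)%g%:R * (z ^+ val l) ^+ i
  | inr l => \sum_(i < N) (y == x * r ^+ i)%g%:R * (z ^+ val l) ^+ i
  end.
have csum (v : {ffun gT -> algC^o}) x1 l :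
  \sum_y (v y : algC) * (\sum_(i < N) (y == x1 * r ^+ i)%g%:R * (z ^+ l) ^+ i)
    = hat N (on_coset v x1) (z ^+ l).
  under eq_bigr do rewrite mulr_sumr.
  rewrite exchange_big; apply: eq_bigr => i _ /=.
  rewrite (bigD1 (x1 * r ^+ i)%g) //= eqxx mul1r big1 ?addr0 // => y /negPf->.
  by rewrite mul0r mulr0.
have -> : (N - #|dbl| + #|bad|)%N = #|J|.
  rewrite card_sum !card_sig; congr (_ + _)%N.
  by rewrite -[X in (X - _)%N](card_ord N) -(cardC dbl) addKn.
apply: (dim_le_functionals (c := c)) => v Wv cv.
have hat2 (l : 'I_N) : hat N (on_coset v (x * s)%g) (z ^+ l) = 0.
  have [/(Hdbl _ _ Wv)//|dl] := boolP (dbl l).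
  by rewrite -csum; apply: (cv (inl (exist _ l dl))).
have hat1 (l : 'I_N) : hat N (on_coset v x) (z ^+ l) = 0.
  have [bl|/Hbad->//] := boolP (bad l).
  by rewrite -csum; apply: (cv (inr (exist _ l bl))).
have N0 : N%:R != 0 :> algC by rewrite pnatr_eq0 -lt0n.
apply/ffunP=> y; rewrite ffunE.
have [i lti Hy] := frame_elt frame (x^-1 * y)%g.
have [|] := Hy => /(canRL (mulKVg _)) ->; last rewrite mulgA.
  exact: (hat_inj prim_z N0 (fun l ltl => hat1 (Ordinal ltl)) lti).
exact: (hat_inj prim_z N0 (fun l ltl => hat2 (Ordinal ltl)) lti).
Qed.

Section Relations.

Variables (v : {ffun gT -> algC^o}) (x : gT).

Let a := coset_size x.
Let b := coset_size (x * s)%g.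

Let n0 : #|gT|%:R != 0 :> algC.
Proof. by rewrite pnatr_eq0 -cardsT -lt0n cardG_gt0. Qed.

Lemma const_hat (P : nat -> algC) K w :
  (forall j, (j < N)%N -> #|gT|%:R * P j = K) -> w ^+ N = 1 -> w != 1 ->
  \sum_(j < N) P j * w ^+ j = 0.
Proof.
move=> PK wN w1; apply: (mulfI n0); rewrite mulr0 mulr_sumr.
rewrite (eq_bigr (fun j : 'I_N => K * w ^+ j)) => [|j _]; last by rewrite mulrA PK.
by rewrite -mulr_sumr geometric_sum_root ?mulr0.
Qed.

Lemma balanced_rotation j : v \in balanced S <[r]>%g ->
  #|gT|%:R * (\sum_(i < N) on_coset v x i * (coset_ind x (i + j))%:R +
    \sum_(i < N) on_coset v (x * s)%g i * (coset_ind (x * s)%g (i + j))%:R)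
  = #|S|%:R * (\sum_y (v y : algC)).
Proof.
move/balancedP/(_ (r ^+ j)%g (mem_cycle _ _)) <-; congr (_ * _).
rewrite [RHS](frame_sum frame _ x) /=.
by congr (_ + _); apply: eq_bigr => i _; rewrite /coset_ind expgD !mulgA.
Qed.

Lemma balanced_reflection j : v \in balanced S [set: gT] ->
  #|gT|%:R * (\sum_(i < N) on_coset v x i * (coset_ind (x * s)%g (N - i + j))%:R +
    \sum_(i < N) on_coset v (x * s)%g i * (coset_ind x (N - i + j))%:R)
  = #|S|%:R * (\sum_y (v y : algC)).
Proof.
have [_ or _ ss _] := frame.
have rN (i : 'I_N) : (r ^+ (N - i) = r ^- i)%g.
  apply/(mulgI (r ^+ i)%g); rewrite -expgD subnKC 1?ltnW // mulgV.
  by rewrite -or expg_order.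
move/balancedP/(_ (s * r ^+ j)%g (in_setT _)) <-; congr (_ * _).
rewrite [RHS](frame_sum frame _ x) /=; congr (_ + _); apply: eq_bigr => i _.
  congr (_ * (nat_of_bool (_ \in S))%:R).
  by rewrite expgD rN -[in RHS]mulgA (mulgA (r ^+ i)%g) (frame_reflect frame) !mulgA.
congr (_ * (nat_of_bool (_ \in S))%:R).
rewrite expgD rN -[in RHS]mulgA (mulgA (r ^+ i)%g) (frame_reflect frame) !mulgA.
by rewrite -(mulgA x s s) ss mulg1.
Qed.

(** Being balanced for the translates of [S] by rotations is a correlation
    equation on each coset, and the transform turns it into one linear equation
    at each nontrivial root. *)
Lemma hat_rotation w : v \in balanced S <[r]>%g -> w ^+ N = 1 -> w != 1 ->
  hat N (on_coset v x) w * nhat N (coset_ind x) w^-1 +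
  hat N (on_coset v (x * s)%g) w * nhat N (coset_ind (x * s)%g) w^-1 = 0.
Proof.
move=> bal wN w1.
have wVN : w^-1 ^+ N = 1 by rewrite exprVn wN invr1.
have w0 := unity_root_neq0 N_gt0 wN.
have := const_hat (fun j _ => balanced_rotation j bal) wVN.
rewrite invr_eq1 => /(_ w1).
under eq_bigr do rewrite mulrDl.
rewrite big_split /=.
have per y : periodic N (fun i => (coset_ind y i)%:R : algC).
  by move=> i; rewrite coset_ind_periodic.
have wV0 : w^-1 != 0 by rewrite invr_eq0.
have := hat_correlation (on_coset v x) (per x) wVN wV0.
have := hat_correlation (on_coset v (x * s)%g) (per (x * s)%g) wVN wV0.
by rewrite !invrK => -> ->.
Qed.

(** Reflections exchange the two cosets and reverse them, which turns the
    correlations into convolutions and gives a second equation at the same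
    root. *)
Lemma hat_reflection w : v \in balanced S [set: gT] -> w ^+ N = 1 -> w != 1 ->
  hat N (on_coset v x) w * nhat N (coset_ind (x * s)%g) w +
  hat N (on_coset v (x * s)%g) w * nhat N (coset_ind x) w = 0.
Proof.
move=> bal wN w1.
have w0 := unity_root_neq0 N_gt0 wN.
have := const_hat (fun j _ => balanced_reflection j bal) wN w1.
under eq_bigr do rewrite mulrDl.
rewrite big_split /=.
have per y : periodic N (fun i => (coset_ind y i)%:R : algC).
  by move=> i; rewrite coset_ind_periodic.
have := hat_convolution (on_coset v x) (per (x * s)%g) wN w0.
have := hat_convolution (on_coset v (x * s)%g) (per x) wN w0.
by move=> -> ->.
Qed.

(** At the trivial root the constant term, which is proportional to the total
    mass of [v], does not cancel. Combined with it the equation becomes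
    [(a - b) * (h1 - h2) = 0], where [h1] and [h2] are the masses of the two
    halves of [v]. *)
Lemma hat_trivial : v \in balanced S <[r]>%g -> a != b ->
  hat N (on_coset v x) 1 = hat N (on_coset v (x * s)%g) 1.
Proof.
move=> bal neq_ab; have [oG _ _ _ _] := frame.
have N0 : N%:R != 0 :> algC by rewrite pnatr_eq0 -lt0n.
have per y : periodic N (fun i => (coset_ind y i)%:R : algC).
  by move=> i; rewrite coset_ind_periodic.
have cor y : \sum_(j < N) (\sum_(i < N) on_coset v y i * (coset_ind y (i + j))%:R)
   = hat N (on_coset v y) 1 * (coset_size y)%:R.
  have := hat_correlation (on_coset v y) (per y) (expr1n _ N) (oner_neq0 _).
  rewrite invr1 -/(nhat N (coset_ind y) 1) nhat1 => <-.
  by apply: eq_bigr => j _; rewrite expr1n mulr1.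
have : \sum_(j < N) (#|gT|%:R *
    (\sum_(i < N) on_coset v x i * (coset_ind x (i + j))%:R +
    \sum_(i < N) on_coset v (x * s)%g i * (coset_ind (x * s)%g (i + j))%:R))
   = \sum_(j < N) #|S|%:R * (\sum_y (v y : algC)).
  by apply: eq_bigr => j _; apply: balanced_rotation.
rewrite -mulr_sumr big_split /= !cor sumr_const card_ord -mulr_natl.
rewrite (frame_sum frame _ x) /= -(coset_size_sum x) oG.
rewrite -!/(on_coset v _ _) -/a -/b.
have -> : \sum_(i < N) on_coset v x i = hat N (on_coset v x) 1 by rewrite hat1.
have -> : \sum_(i < N) on_coset v (x * s)%g i =
    hat N (on_coset v (x * s)%g) 1 by rewrite hat1.
set h1 := hat _ _ _; set h2 := hat _ _ _ => E.
have : N%:R * ((a%:R - b%:R) * (h1 - h2)) = 0 :> algC.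
  move/eqP: E; rewrite natrM natrD -subr_eq0 => /eqP E.
  by rewrite -[RHS]E; ring.
move/eqP; rewrite !mulf_eq0 (negPf N0) /= !subr_eq0 eqr_nat (negPf neq_ab) /=.
by move/eqP.
Qed.

End Relations.
End BalancedDimension.

Lemma cramer2 (R : comPzRingType) (h1 h2 f f' g g' : R) :
  h1 * f' + h2 * g' = 0 -> h1 * g + h2 * f = 0 -> (f * f' - g * g') * h2 = 0.
Proof.
move=> E1 E2.
have -> : (f * f' - g * g') * h2 = f' * (h1 * g + h2 * f) - g * (h1 * f' + h2 * g').
  by ring.
by rewrite E1 E2 !mulr0 subrr.
Qed.

Section PrimeSquareDimension.

Variables (gT : finGroupType) (p : nat) (r s : gT).
Hypothesis p_pr : prime p.
Let N := (p ^ 2)%N.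
Hypothesis frame : dihedral_frame N r s.
Variable S : {set gT}.

Local Notation coset_ind := (coset_ind r S).
Local Notation coset_size := (coset_size N r S).

Let p_gt0 : (0 < p)%N. Proof. exact: prime_gt0. Qed.
Let p_gt1 : (1 < p)%N. Proof. exact: prime_gt1. Qed.
Let N_gt0 : (0 < N)%N. Proof. by rewrite expn_gt0 p_gt0. Qed.

(** At a root outside [bad] the equation of [hat_rotation], or of [hat_trivial]
    at 1, has a nonzero coefficient at the first half of the vector. *)
Lemma dim_balanced_rotations x (bad : pred 'I_N) (z : algC) :
  N.-primitive_root z ->
  (forall l : 'I_N, l = 0%N :> nat -> ~~ bad l ->
    coset_size x != coset_size (x * s)%g) ->
  (forall l : 'I_N, l != 0%N :> nat -> ~~ bad l ->
    nhat N (coset_ind x) (z ^+ l)^-1 != 0) ->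
  (\dim (balanced S <[r]>%g) <= N + #|bad|)%N.
Proof.
move=> prim_z bad0 badN0.
have := @dim_le_hat _ _ _ _ frame _ prim_z (balanced S <[r]>%g) x pred0 bad.
rewrite card0 subn0; apply=> // v l bal nbl hat2.
have [l0|l0] := eqVneq (l : nat) 0%N.
  move: hat2; rewrite l0 expr0 => hat2.
  by rewrite (hat_trivial frame bal (bad0 l l0 nbl)) hat2.
have [zlN _] := root_unit frame prim_z l.
have zl1 : z ^+ l != 1.
  by rewrite -(prim_order_dvd prim_z) /dvdn modn_small.
have /eqP := hat_rotation frame x bal zlN zl1.
by rewrite hat2 mul0r addr0 mulf_eq0 (negPf (badN0 l l0 nbl)) orbF => /eqP.
Qed.

Lemma nhat_inv_neq0 x l (z : algC) : N.-primitive_root z ->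
  ~~ (p %| coset_size x)%N -> nhat N (coset_ind x) (z ^+ l)^-1 != 0.
Proof.
move=> prim_z; apply: contraNneq => /(nhat_zero_dvd p_pr) -> //.
  exact: (coset_ind_periodic frame).
by have [zlN _] := root_unit frame prim_z l; rewrite exprVn zlN invr1.
Qed.

Lemma dim_balanced_coprime x : ~~ (p %| coset_size x)%N ->
  (\dim (balanced S <[r]>%g) <= N + (coset_size x == coset_size (x * s)%g))%N.
Proof.
move=> px; have [z prim_z] := C_prim_root_exists N_gt0.
set ab := _ == _.
have -> : nat_of_bool ab = #|[pred l : 'I_N | (l == Ordinal N_gt0) && ab]|.
  case: ab; last by rewrite eq_card0 // => l; rewrite !inE andbF.
  by rewrite (@eq_card1 _ (Ordinal N_gt0)) // => l; rewrite !inE ?andbT.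
apply: (dim_balanced_rotations (x := x) prim_z) => l l0.
  by rewrite /= -val_eqE /= l0 eqxx.
by move=> _; apply: nhat_inv_neq0.
Qed.

Lemma card_multiples : (#|[pred l : 'I_N | (p %| l)%N]| <= p)%N.
Proof.
have ltq (l : 'I_N) : (l %/ p < p)%N by rewrite ltn_divLR // mulnn.
pose h l := Ordinal (ltq l).
rewrite -(card_in_imset (f := h)).
  by rewrite -[X in (_ <= X)%N](card_ord p) max_card.
move=> l l'; rewrite !inE => pl pl' /(congr1 val) /= eq_div.
by apply: val_inj; rewrite /= -(divnK pl) -(divnK pl') eq_div.
Qed.

(** When the part of [S] in one coset is not [p]-periodic, its transform
    vanishes at no root of order [p ^ 2]; the [p]-th roots are the only bad
    ones. *)
Lemma dim_balanced_nonperiodic x : (exists i, coset_ind x (i + p) <> coset_ind x i) ->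
  (\dim (balanced S <[r]>%g) <= N + (p - 1 + (coset_size x == coset_size (x * s)%g)))%N.
Proof.
case=> i0 nper; have [z prim_z] := C_prim_root_exists N_gt0.
set ab := _ == _.
pose bad := [pred l : 'I_N | (p %| l)%N && ((l != Ordinal N_gt0) || ab)].
have card_bad : (#|bad| <= p - 1 + ab)%N.
  have := card_multiples; rewrite (cardD1 (Ordinal N_gt0)) inE dvdn0 add1n => lep.
  rewrite (cardD1 (Ordinal N_gt0)) inE /= dvdn0 /= addnC leq_add2r.
  rewrite -ltnS subn1 prednK //; apply: leq_trans lep; rewrite ltnS.
  by apply/subset_leq_card/subsetP=> l; rewrite !inE => /andP[-> /andP[-> _]].
apply: leq_trans (leq_add (leqnn N) card_bad).
apply: (dim_balanced_rotations (x := x) prim_z) => l l0.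
  by rewrite /bad /= l0 dvdn0 -val_eqE /= l0 eqxx.
rewrite /bad /= -val_eqE /= l0 andbT => pl.
apply/eqP=> hat0; apply: nper.
have prim_z' : N.-primitive_root z^-1.
  have -> : z^-1 = z ^+ N.-1.
    have z0 := unity_root_neq0 N_gt0 (prim_expr_order prim_z).
    apply: (mulfI z0).
    by rewrite divff -?exprS ?prednK ?(prim_expr_order prim_z).
  by rewrite prim_root_exp_coprime // coprimePn.
apply: (nhat_periodic p_pr prim_z') (coset_ind_periodic frame S x) _ i0.
by exists l; rewrite // exprVn.
Qed.

Lemma balanced_sub (H K : {set gT}) : K \subset H -> (balanced S H <= balanced S K)%VS.
Proof.
move=> sKH; apply/subvP=> v /balancedP bal; apply/balancedP=> h Kh.
exact/bal/(subsetP sKH).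
Qed.

(** Here the two equations at a root [w] have determinant [norm_gap] at [w],
    which is nonzero for [p - 1] roots; there both halves vanish. *)
Lemma dim_balanced_full x : ~~ (p %| coset_size x)%N ->
  coset_size x <> coset_size (x * s)%g -> #|S| <> N ->
  (\dim (balanced S [set: gT]) <= N - (p - 1))%N.
Proof.
move=> px neq_ab neq_N; have [z prim_z] := C_prim_root_exists N_gt0.
have ind1 y i : (coset_ind y i <= 1)%N by apply: leq_b1.
have [q q1p gap] := norm_gap_nonzero p_pr prim_z (ind1 x) (ind1 (x * s)%g) neq_ab
  ltac:(by rewrite -/(coset_size x) -/(coset_size (x * s)%g) (coset_size_sum frame)).
have q_gt0 : (0 < q)%N by case/orP: q1p => /eqP->.
have lt_tq (t : 'I_p) : (t * q < N)%N.
  by have := ltn_ord t; case/orP: q1p => /eqP->; rewrite /N; nia.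
pose ext (t : 'I_p) : 'I_N := Ordinal (lt_tq t).
pose nz := [set t : 'I_p | (0 < t)%N].
pose dbl := [pred l : 'I_N | l \in ext @: nz].
have card_dbl : #|dbl| = (p - 1)%N.
  transitivity #|ext @: nz|; first exact: eq_card.
  rewrite card_imset; last first.
    move=> t t' /(congr1 val) /= /eqP; rewrite eqn_pmul2r // => /eqP.
    exact: val_inj.
  have -> : nz = [set~ Ordinal p_gt0]%SET.
    by apply/setP=> t; rewrite !inE -val_eqE /= lt0n.
  by rewrite cardsC1 card_ord subn1.
have unit_l (l : 'I_N) : l != 0%N :> nat -> (z ^+ l) ^+ N = 1 /\ z ^+ l != 1.
  move=> l0; have [zlN _] := root_unit frame prim_z l; split=> //.
  by rewrite -(prim_order_dvd prim_z) /dvdn modn_small.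
have sub v : v \in balanced S [set: gT] -> v \in balanced S <[r]>%g.
  exact/subvP/balanced_sub/subsetT.
have := @dim_le_hat _ _ _ _ frame _ prim_z (balanced S [set: gT]) x dbl pred0.
rewrite card0 addn0 card_dbl; apply=> v l bal.
  case/imsetP=> t; rewrite inE => t_gt0 def_l.
  have l0 : l != 0%N :> nat by rewrite def_l /= muln_eq0 negb_or -!lt0n t_gt0.
  have [zlN zl1] := unit_l l l0.
  have E1 := hat_rotation frame x (sub v bal) zlN zl1.
  have E2 := hat_reflection frame x bal zlN zl1.
  have := gap t; rewrite t_gt0 ltn_ord => /(_ isT).
  have -> : (t * q)%N = l by rewrite def_l.
  move=> gap_l; apply: (mulfI gap_l); rewrite mulr0.
  exact: cramer2 E1 E2.
move=> _ hat2.
have [l0|l0] := eqVneq (l : nat) 0%N.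
  move: hat2; rewrite l0 expr0 => <-.
  by apply: (hat_trivial frame (sub v bal)); apply/eqP.
have [zlN zl1] := unit_l l l0.
have /eqP := hat_rotation frame x (sub v bal) zlN zl1.
rewrite hat2 mul0r addr0 mulf_eq0 (negPf (nhat_inv_neq0 l prim_z px)) orbF.
by move/eqP.
Qed.

End PrimeSquareDimension.

Local Close Scope ring_scope.

(** * Counting letters *)

(** Number of letters that suffice to enlarge a set of [k] elements. *)
Definition step_cost (p k : nat) : nat :=
  if p %| k then 2 * p ^ 2 + (p - 1)
  else if odd k then 2 * p ^ 2 - (p - 1) else 2 * p ^ 2.

(** The sizes divisible by [p] may cost more than [2 * p ^ 2], but the odd sizes
    prime to [p] save the same amount and outnumber them sufficiently. The cost
    is periodic of period [2 * p], and a period contains two multiples of [p]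
    against [p - 1] odd numbers prime to [p]. *)
Lemma sum_step_cost p : prime p -> odd p ->
  \sum_(2 <= k < 2 * p ^ 2) step_cost p k <= 2 * p ^ 2 * (2 * p ^ 2 - 2).
Proof.
move=> p_pr odd_p; have p_gt2 := odd_prime_gt2 odd_p p_pr.
set n := 2 * p ^ 2; have n_p : p <= n by rewrite /n; nia.
have costE k : step_cost p k = if p %| k then n + (p - 1)
    else if odd k then n - (p - 1) else n by [].
have def_n : n = 2 * p ^ 2 by [].
clearbody n.
have per k : step_cost p (k + 2 * p) = step_cost p k.
  rewrite !costE dvdn_addl ?dvdn_mull // oddD oddM /= addbF.
  by [].
have multE : \sum_(k < 2 * p) (p %| k) = 2.
  rewrite mul2n -addnn big_split_ord /=.
  have one m : (p %| m) -> \sum_(k < p) (p %| m + k) = 1.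
    move=> pm; rewrite (bigD1 (Ordinal (ltnW (ltnW p_gt2)))) //= addn0 pm.
    rewrite big1 // => k k0.
    rewrite dvdn_addr // gtnNdvd ?ltn_ord // lt0n.
    by apply: contra k0 => k0; rewrite -val_eqE.
  by rewrite (one 0) ?(one p).
have oddE : \sum_(k < 2 * p) odd k = p.
  rewrite mul2n; elim: (p) => [|m IHm]; first by rewrite big_ord0.
  by rewrite doubleS !big_ord_recr IHm /= odd_double addn0 addn1.
have oddmultE : \sum_(k < 2 * p) ((p %| k) && odd k) = 1.
  rewrite mul2n -addnn big_split_ord /= big1 => [|k _]; last first.
    case: k => [[|k] ltk] /=; first by rewrite andbF.
    by rewrite gtnNdvd.
  rewrite (bigD1 (Ordinal (ltnW (ltnW p_gt2)))) //= addn0 dvdnn odd_p big1 // => k k0.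
  rewrite dvdn_addr // gtnNdvd ?ltn_ord // lt0n.
  by apply: contra k0 => k0; rewrite -val_eqE.
have block : \sum_(k < 2 * p) step_cost p k + (p - 1) * p = 2 * p * n + (p - 1) * 3.
  (* With this correction the summand is a combination of the indicators summed
     above; an odd multiple of [p] receives the weight twice. *)
  have : \sum_(k < 2 * p) (step_cost p k + (p - 1) * odd k) =
      \sum_(k < 2 * p) (n + (p - 1) * ((p %| k) + ((p %| k) && odd k))).
    apply: eq_bigr => k _; rewrite costE.
    by case: (p %| k); case: (odd k) => /=; lia.
  rewrite !big_split -!big_distrr /= ?big_split /= ?oddE ?multE ?oddmultE.
  rewrite ?sum_nat_const ?card_ord.
  lia.
have total : \sum_(k < n) step_cost p k = p * \sum_(k < 2 * p) step_cost p k.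
  have -> : n = p * (2 * p) by rewrite def_n; lia.
  exact: sum_blocks.
have n2 : 2 <= n by apply: leq_trans n_p; apply: ltnW.
have : \sum_(k < n) step_cost p k = 2 * n + \sum_(2 <= k < n) step_cost p k.
  rewrite -(big_mkord xpredT) (big_cat_nat _ n2) //=; congr (_ + _).
  rewrite !big_nat_recr //= big_nil !costE dvdn0 /= gtnNdvd ?(ltnW p_gt2) //.
  lia.
rewrite total; move: block; set B := \sum_(k < _) _; set R := \sum_(2 <= k < _) _.
move=> /(congr1 (muln p)) block split; rewrite mulnBr leq_subRL ?leq_mul //.
have sq : p * (2 * p * n) = n * n by rewrite {2}def_n; ring.
rewrite !mulnDr split sq in block.
have le3 : p * ((p - 1) * 3) <= p * ((p - 1) * p) by rewrite !leq_mul.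
by rewrite mulnC; lia.
Qed.

Lemma merging_letter (X : finType) (Sg : automaton X) :
  synchronizing Sg -> 1 < #|X| ->
  exists f, exists y, f \in Sg /\ 1 < #|[set x | f x == y]|.
Proof.
case=> w /andP[Sw /eqP im1] X_gt1.
have [/forall_inP inj|] := boolP [forall f in Sg, injectiveb f].
  suff injw : injective (fun x : X => word_act x w).
    by move: im1 X_gt1; rewrite /word_image card_imset // cardsT => ->.
  elim: w Sw {im1} => [_ x y //|f w IHw /= /andP[Sf Sw] x y /(IHw Sw)].
  by move/injectiveP: (inj f Sf); apply.
rewrite negb_forall_in => /exists_inP[f Sf /injectivePn[x [y neq_xy eq_f]]].
exists f, (f x); split=> //.
have <- : #|[set x; y]| = 2 by rewrite cards2 neq_xy.
by apply/subset_leq_card/subsetP=> t; rewrite !inE => /orP[] /eqP-> //; rewrite eq_f.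
Qed.

(** The unit vector at a point of [S] is not balanced. *)
Lemma dim_balanced_proper (gT : finGroupType) (S : {set gT}) (H : {group gT}) :
  0 < #|S| < #|gT| -> \dim (balanced S H) <= #|gT| - 1.
Proof.
case/andP=> S_gt0 S_lt; have n_gt0 := leq_ltn_trans S_gt0 S_lt.
rewrite subn1 -ltnS prednK ?(ltn_trans S_gt0) //.
rewrite -(dim_ffun_regular gT algC) (ltn_leqif (dimv_leqif_sup (subvf _))).
have /card_gt0P[x Sx] := S_gt0.
apply/negP=> full; pose v : {ffun gT -> algC^o} := [ffun y => (y == x)%:R]%R.
have /balancedP/(_ 1%g (group1 _)) : v \in balanced S H.
  by apply: (subvP full); apply: memvf.
have sumv (F : gT -> algC) : (\sum_y (v y : algC) * F y = F x)%R.
  rewrite (bigD1 x) //= big1 => [|y /negPf nyx]; last by rewrite ffunE nyx mul0r.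
  by rewrite ffunE eqxx mul1r addr0.
have -> : (\sum_y (v y : algC) = 1)%R.
  by rewrite -(sumv (fun=> 1%R)); apply: eq_bigr => y _; rewrite mulr1.
rewrite sumv mulg1 Sx !mulr1 => /eqP; rewrite eqr_nat => /eqP E.
by rewrite E ltnn in S_lt.
Qed.

Section Steps.

Variables (gT : finGroupType) (p : nat) (r s : gT) (D : {set gT}).
Variable Sg : automaton gT.
Hypotheses (p_pr : prime p) (odd_p : odd p).
Hypothesis frame : dihedral_frame (p ^ 2) r s.
Hypothesis words : forall m, odd m -> short_words r D m.
Hypotheses (sub_D : cayley_graph D \subset Sg) (sync : synchronizing Sg).

Lemma translation_word (w : seq gT) : all [in D] w ->
  exists u, [/\ word_over Sg u, size u = size w &
    forall x, word_act x u = (x * \prod_(d <- w) d)%g].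
Proof.
elim: w => [|d w IHw] /=; first by exists [::]; split=> // x; rewrite big_nil mulg1.
case/andP=> Dd /IHw[u [Su su actu]].
exists (right_translation d :: u); split=> [||x]; rewrite /= ?su //.
  by rewrite /word_over /= (subsetP sub_D) ?imset_f.
by rewrite /word_act /= -/(word_act _ u) actu ffunE big_cons mulgA.
Qed.

(** Let [a] and [b] be the sizes of the parts of [S] in two cosets of the
    rotations. If [a = b] one can average over the rotations, which have
    shorter words; if not, one averages over the whole group, and the equation
    at the trivial root of unity saves one dimension. The three dimension
    bounds cover the cases where [p] does not divide [a], where moreover
    [a] and [b] differ and [#|S|] is odd, and where [S] is not invariant under
    [r ^+ p]. A set invariant under [r ^+ p] gets the trivial dimension bound,
    but only needs words modulo [r ^+ p]. *)
Lemma step_exists (S : {set gT}) : 0 < #|S| < #|gT| ->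
  exists w, [/\ word_over Sg w, size w <= step_cost p #|S| &
    #|S| < #|[set x | word_act x w \in S]|].
Proof.
move=> S_bounds; have [oG or _ _ _] := frame; set N := p ^ 2 in oG or *.
have p_gt1 := prime_gt1 p_pr; have p_gt2 := odd_prime_gt2 odd_p p_pr.
have N_p : 2 * p <= N by rewrite /N; nia.
have odd_N : odd N by rewrite oddX odd_p orbT.
have card_gt : #|gT| = 2 * N by [].
have cosetsT (x : gT) :
    (#|(x *: [set: gT]%G)%g :&: S| * #|gT| = #|[set: gT]%G| * #|S|)%N.
  have -> : (x *: [set: gT]%G = [set: gT])%g.
    by apply/setP=> y; rewrite mem_lcoset !inE.
  by rewrite setTI cardsT mulnC.
have word m h (u : seq gT) : (forall x, (x * r ^+ m \in S)%g = (x \in S)) ->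
    all [in D] u -> (h^-1 * \prod_(d <- u) d)%g \in <[r ^+ m]>%g ->
    exists w, [/\ word_over Sg w, size w <= size u &
      forall x, (word_act x w \in S) = (x * h \in S)%g].
  move=> inv Du /cycleP[j def_j]; have [w [Sw sw actw]] := translation_word Du.
  exists w; split; rewrite ?sw // => x.
  rewrite actw -(mulKVg h (\prod_(d <- u) d)%g) def_j mulgA.
  by elim: j {def_j} => [|j IHj]; rewrite ?mulg1 // expgSr mulgA inv.
have invN x : (x * r ^+ N \in S)%g = (x \in S).
  by rewrite (_ : r ^+ N = 1)%g ?mulg1 // -or expg_order.
have expandT a c : \dim (balanced S [set: gT]) <= a -> a + N <= c ->
    exists w, [/\ word_over Sg w, size w <= c &
      #|S| < #|[set x | word_act x w \in S]|].
  move=> dim_a le_c; have := expand_set sync S_bounds cosetsT _ dim_a (L := N).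
  case=> [h _|w [Sw sw big_w]]; last by exists w; split=> //; apply: leq_trans le_c.
  have [_ /(_ h)[u [Du su hu]]] := words odd_N.
  have [w [Sw sw actw]] := word N h u invN Du hu.
  by exists w; split=> //; apply: leq_trans su.
have expandC x a c : coset_size N r S x = coset_size N r S (x * s)%g ->
    \dim (balanced S <[r]>%g) <= a -> a + (N - 1) <= c ->
    exists w, [/\ word_over Sg w, size w <= c &
      #|S| < #|[set x | word_act x w \in S]|].
  move=> half dim_a le_c.
  have cosetsC y : (#|(y *: <[r]>)%g :&: S| * #|gT| = #|<[r]>%g| * #|S|)%N.
    rewrite (coset_size_card frame) -orderE or card_gt -(coset_size_sum frame S x).
    have -> : coset_size N r S y = coset_size N r S x.
      have [_ cov] := frame_cosets frame x.
      have: y \in [set: gT] by rewrite inE.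
      rewrite -cov => /setUP[] /(coset_size_lcoset frame S) -> //.
    by rewrite -/N -half; ring.
  have := expand_set sync S_bounds cosetsC _ dim_a (L := N - 1).
  case=> [h rh|w [Sw sw big_w]]; last by exists w; split=> //; apply: leq_trans le_c.
  have [/(_ h rh)[u [Du su hu]] _] := words odd_N.
  have [w [Sw sw actw]] := word N h u invN Du hu.
  exists w; split=> //; rewrite (leq_trans sw) // subn1 -ltnS prednK //.
  exact: leq_trans su.
have dimT a : \dim (balanced S <[r]>%g) <= a -> \dim (balanced S [set: gT]) <= a.
  by apply: leq_trans; apply/dimvS/balanced_sub/subsetT.
have [pS|pS] := boolP (p %| #|S|); last first.
  have [x px] : exists x, ~~ (p %| coset_size N r S x).
    have [p1|] := boolP (p %| coset_size N r S 1%g); last by exists 1%g.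
    exists (1 * s)%g; apply: contra pS => ps.
    by rewrite -(coset_size_sum frame S 1%g) dvdn_add.
  have sumS := coset_size_sum frame S x.
  have := dim_balanced_coprime p_pr frame px.
  have [half|not_half] := eqVneq (coset_size N r S x) (coset_size N r S (x * s)%g).
    move=> dimC; apply: (expandC x _ _ half dimC).
    rewrite /step_cost (negPf pS) -sumS -half addnn odd_double; lia.
  rewrite addn0 => dimC; rewrite /step_cost (negPf pS).
  have [odd_k|even_k] := boolP (odd #|S|).
    have neqN : #|S| <> N by move=> SN; case/negP: pS; rewrite SN /N expnS dvdn_mulr.
    have /eqP neq_half := not_half.
    apply: (expandT _ _ (dim_balanced_full p_pr frame px neq_half neqN)).
    by rewrite -/N; lia.
  apply: (expandT _ _ (dimT _ dimC)); rewrite -/N; lia.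
have costE : step_cost p #|S| = 2 * N + (p - 1) by rewrite /step_cost pS.
have [invp|] := boolP [forall x, (x * r ^+ p \in S)%g == (x \in S)]; last first.
  rewrite negb_forall => /existsP[x /eqP nper].
  have nperx : exists i, coset_ind r S x (i + p) <> coset_ind r S x i.
    exists 0; rewrite /coset_ind expg0 mulg1 => E; apply: nper.
    by move: E; case: (_ \in S); case: (_ \in S).
  have := dim_balanced_nonperiodic p_pr frame nperx.
  have [half|not_half] := eqVneq (coset_size N r S x) (coset_size N r S (x * s)%g).
    by move=> dimC; apply: (expandC x _ _ half dimC); rewrite costE; lia.
  by rewrite addn0 => /dimT dimC; apply: (expandT _ _ dimC); rewrite costE; lia.
have {}invp x : (x * r ^+ p \in S)%g = (x \in S) by apply/eqP/(forallP invp).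
have dim_n := dim_balanced_proper [set: gT]%G S_bounds.
have := expand_set sync S_bounds cosetsT _ dim_n (L := p).
case=> [h _|w [Sw sw big_w]].
  have [_ /(_ h)[u [Du su hu]]] := words odd_p.
  have [w [Sw sw actw]] := word p h u invp Du hu.
  by exists w; split=> //; apply: leq_trans su.
exists w; split=> //; apply: leq_trans sw _; rewrite costE card_gt; lia.
Qed.

Lemma chain_of_steps (S : {set gT}) : 1 < #|S| ->
  exists w, [/\ word_over Sg w, size w <= \sum_(#|S| <= k < #|gT|) step_cost p k &
    forall x, word_act x w \in S].
Proof.
have [d le_d] := ubnP (#|gT| - #|S|); elim: d => // d IHd in S le_d * => S_gt1.
have [leS|ltS] := leqP #|gT| #|S|.
  exists [::]; split=> // x; suff -> : S = setT by rewrite inE.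
  by apply/eqP; rewrite eqEcard subsetT cardsT.
have [|w [Sw sw]] := step_exists (S := S); first by rewrite ltS ltnW.
set S' := [set x | _] => bigS'.
have [||u [Su su actu]] := IHd S'; [lia | lia |].
exists (u ++ w); split.
- by rewrite /word_over all_cat; apply/andP.
- rewrite size_cat (big_cat_nat _ (n := #|S'|)) /=; last 2 first.
  + exact: ltnW.
  + exact: max_card.
  rewrite addnC leq_add // (leq_trans sw) // big_ltn // leq_addr //.
by move=> x; rewrite word_act_cat; have := actu x; rewrite inE.
Qed.

End Steps.

(* 'D_m is the dihedral group of order m. *)
Theorem theorem5p10 (p : nat) (gT : finGroupType) :
  prime p -> odd p -> [set: gT] \isog 'D_(2 * p ^ 2)%N -> cerny_group gT.
Proof.
move=> p_pr odd_p isoG D genD Sg sub_D sync.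
have p_gt1 := prime_gt1 p_pr.
have [r0 [s0 frame0]] := dihedral_frame_exists (ltn_exp2l 0 2 p_gt1) isoG.
have [r [s [frame words]]] := short_words_exist p_pr frame0 genD.
have [oG _ _ _ _] := frame.
have chain := chain_of_steps p_pr odd_p frame words sub_D sync.
have n_gt1 : 1 < #|gT| by rewrite oG; nia.
have [f [y [Sf fiber_gt1]]] := merging_letter sync n_gt1.
have [w [Sw sw actw]] := chain _ fiber_gt1.
exists (w ++ [:: f]).
  rewrite /synchronizing_word /word_over all_cat; apply/andP; split.
    by rewrite /= Sf !andbT; apply: Sw.
  apply/cards1P; exists y; apply/setP=> z; rewrite inE; apply/imsetP/eqP.
    by case=> x _ ->; rewrite word_act_cat; have := actw x; rewrite inE => /eqP.
  move=> ->; exists 1%g; rewrite ?inE // word_act_cat.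
  by have := actw 1%g; rewrite inE => /eqP.
rewrite size_cat /= addn1.
have sum_le := sum_step_cost p_pr odd_p.
have : size w <= \sum_(2 <= k < #|gT|) step_cost p k.
  apply: leq_trans sw _.
  rewrite [X in _ <= X](big_cat_nat _ (n := #|[set x | f x == y]|)) ?leq_addl //=.
  exact: max_card.
rewrite -oG in sum_le; move/leq_trans/(_ sum_le) => le_w; apply: leq_ltn_trans le_w _.
by case: #|gT| n_gt1 => [|[|m]] // _; rewrite subn1 !subSS subn0 /=; lia.
Qed.
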